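(* Let $n$ be a positive integer, let $a_0<0$ be real, and let $p\in\mathcal{H}[a_0,n]$. Suppose that there exists a point $z_0\in\mathbb{U}$ such that $\mathrm{Re}(p(z))<0$ for all $z$ with $|z|<|z_0|$, and $p(z_0)=\beta i$ for some real $\beta\neq 0$. Then $$\frac{z_0p'(z_0)}{p(z_0)}=il$$ for a real number $l$ such that $$l\geq \frac{n}{2}\left(\frac{a_0}{\beta}+\frac{\beta}{a_0}\right)\geq n\quad\text{if }\beta<0,$$ and $$l\leq \frac{n}{2}\left(\frac{a_0}{\beta}+\frac{\beta}{a_0}\right)\leq -n\quad\text{if }\beta>0.$$
   Context: $\mathbb{U}=\{z\in\mathbb{C}:|z|<1\}$ is the open unit disk. For $a_0\in\mathbb{C}$ and a positive integer $n$, $\mathcal{H}[a_0,n]$ is the class of functions $p$ analytic in $\mathbb{U}$ of the form $p(z)=a_0+\sum_{k=n}^{\infty}a_kz^k$. *)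

(* Defs.v *)
From Stdlib Require Import Reals.
From Coquelicot Require Import Coquelicot.

Definition unit_disk (z : C) : Prop := (Cmod z < 1)%R.

(* Analytic = complex-differentiable at every point of the (open) disk; both
   normed-module structures are over the complex scalars, so this is not
   differentiability of a map of the real plane. *)
Definition analytic_in_U (p : C -> C) : Prop :=
  forall z : C, unit_disk z ->
    @ex_derive C_AbsRing C_NormedModule p z.

(* The class H[a0, n]; the values of p outside the disk are irrelevant. *)
Definition H_class (a0 : C) (n : nat) (p : C -> C) : Prop :=
  analytic_in_U p /\
  exists a : nat -> C,
    a 0%nat = a0 /\
    (forall k : nat, (0 < k < n)%nat -> a k = RtoC 0) /\
    (forall z : C, unit_disk z ->
       @is_pseries C_AbsRing C_NormedModule a z (p z)).

(* Main.v *)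
Require Import Defs.
From Stdlib Require Import Reals Lra Lia.
From Coquelicot Require Import Coquelicot.
Local Open Scope R_scope.

(* Write c = - a0 and Q(w) = - p(z0 w) = c + O(w^n), so that Re Q >= 0 on the
   closed unit disk and Q(1) = - i beta.  As Re Q is minimal on the circle at
   w = 1, z0 p'(z0) is a real number m, and the claim is
   m >= n (c^2 + beta^2) / (2 c).

   For any kappa, |w| = 1 gives
     (2 |kappa| + 2 Re (kappa w^n)) Re Q(w) = Re G(w),
     G(w) = 2 |kappa| Q + kappa w^n (Q + c) + conj(kappa) w^-n (Q - c),
   where G is analytic on the closed disk because Q - c vanishes to order n at 0.
   So Re G is nonnegative on the circle and zero at 1, hence its radial
   derivative at 1 is nonpositive; kappa = (c + i beta)^2 gives exactly the
   claim.

   The sign of the radial derivative comes from M. Riesz's interpolation formula: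
   at the N points x_j with e^{i N x_j} = -1 and the weights
   1 / (N (1 - cos x_j)), the sum of weight_j (f(0) - f(x_j)) is k for
   f = cos (k x), k <= N.  It is nonpositive if f >= 0 = f(0), and letting N tend
   to infinity yields the derivative. *)

(** * Riesz quadrature and its values on cosines *)

Definition node (M j : nat) : R := (2 * INR j + 1) * PI / INR (S M).

Definition weight (M j : nat) : R := / (INR (S M) * (1 - cos (node M j))).

(** There are N = [S M] points, so N is never zero and the sum up to [M] visits each point once. *)
Definition quad (M : nat) (f : R -> R) : R :=
  sum_f_R0 (fun j => weight M j * (f 0 - f (node M j))) M.

(** Half the node lies strictly between 0 and pi, and 1 - cos x = 2 sin^2 (x/2). *)
Lemma one_minus_cos_node (M j : nat) : (j <= M)%nat -> 0 < 1 - cos (node M j).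
Proof.
intros Hj.
replace (node M j) with (2 * (node M j / 2)) by field.
rewrite cos_2a_sin.
assert (HM : 0 < INR (S M)) by (apply lt_0_INR; lia).
assert (Hj' : INR j + 1 <= INR (S M)) by (rewrite <- S_INR; apply le_INR; lia).
pose proof (pos_INR j) as Hj0.
pose proof PI_RGT_0 as HPI.
assert (Hs : 0 < sin (node M j / 2)).
{ unfold node; apply sin_gt_0.
  - apply Rdiv_lt_0_compat; [|lra].
    apply Rdiv_lt_0_compat; [nra|lra].
  - apply Rmult_lt_reg_r with (2 * INR (S M)); [lra|].
    field_simplify; [nra|lra]. }
nra.
Qed.

Lemma weight_pos (M j : nat) : (j <= M)%nat -> 0 < weight M j.
Proof.
intros Hj; apply Rinv_0_lt_compat, Rmult_lt_0_compat.
- apply lt_0_INR; lia.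
- now apply one_minus_cos_node.
Qed.

Lemma quad_nonpos (M : nat) (f : R -> R) :
  f 0 = 0 -> (forall x, 0 <= f x) -> quad M f <= 0.
Proof.
intros H0 Hf; unfold quad.
apply Rle_trans with (sum_f_R0 (fun _ => 0) M); [|rewrite sum_cte; lra].
apply sum_Rle; intros j Hj.
rewrite H0; pose proof (weight_pos M j Hj); pose proof (Hf (node M j)); nra.
Qed.

Lemma quad_plus (M : nat) (f g : R -> R) :
  quad M (fun x => f x + g x) = quad M f + quad M g.
Proof.
unfold quad; rewrite <- plus_sum; apply sum_eq; intros; ring.
Qed.

Lemma quad_scal (M : nat) (a : R) (f : R -> R) :
  quad M (fun x => a * f x) = a * quad M f.
Proof.
unfold quad; rewrite scal_sum; apply sum_eq; intros; ring.
Qed.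

Lemma is_series_quad (M : nat) (F : nat -> R -> R) (f : R -> R) :
  (forall x, is_series (fun k => F k x) (f x)) ->
  is_series (fun k => quad M (F k)) (quad M f).
Proof.
intros HF; unfold quad.
assert (Hj : forall j, is_series
  (fun k => weight M j * (F k 0 - F k (node M j)))
  (weight M j * (f 0 - f (node M j)))).
{ intros j.
  apply (is_series_scal_l (weight M j) (fun k => F k 0 - F k (node M j))).
  apply (is_series_minus (fun k => F k 0)); apply HF. }
(* The number of summands is decoupled from the [M] inside the nodes, so that the induction does not
   move them. *)
assert (Hm : forall m, is_series
  (fun k => sum_f_R0 (fun j => weight M j * (F k 0 - F k (node M j))) m)
  (sum_f_R0 (fun j => weight M j * (f 0 - f (node M j))) m)); [|apply Hm].
induction m as [|m IH]; simpl; [apply Hj|].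
now apply (is_series_plus (fun k => sum_f_R0 _ m)).
Qed.

(** Since k x_j = (2 j + 1) a, multiplying by 2 sin a makes the sum telescope to sin (2 k pi) = 0,
    while 0 < a < pi keeps sin a nonzero. *)
Lemma sum_cos_node (M k : nat) : (0 < k <= M)%nat ->
  sum_f_R0 (fun j => cos (INR k * node M j)) M = 0.
Proof.
intros Hk.
set (a := INR k * PI / INR (S M)).
assert (HM : 0 < INR (S M)) by (apply lt_0_INR; lia).
assert (Hk0 : 0 < INR k) by (apply lt_0_INR; lia).
assert (Hk1 : INR k < INR (S M)) by (apply lt_INR; lia).
pose proof PI_RGT_0 as HPI.
assert (Hs : 0 < sin a).
{ unfold a; apply sin_gt_0.
  - apply Rdiv_lt_0_compat; nra.
  - apply Rmult_lt_reg_r with (INR (S M)); [lra|].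
    field_simplify; [nra|lra]. }
assert (Htel : forall m,
  2 * sin a * sum_f_R0 (fun j => cos (INR k * node M j)) m
  = sin (2 * INR (S m) * a)).
{ assert (Hstep : forall j, 2 * sin a * cos (INR k * node M j)
    = sin (2 * INR (S j) * a) - sin (2 * INR j * a)).
  { intros j.
    replace (INR k * node M j) with ((2 * INR j + 1) * a)
      by (unfold a, node; field; lra).
    replace (2 * INR (S j) * a) with ((2 * INR j + 1) * a + a)
      by (rewrite S_INR; ring).
    replace (2 * INR j * a) with ((2 * INR j + 1) * a - a) by ring.
    rewrite sin_plus, sin_minus; ring. }
  induction m as [|m IH].
  - simpl sum_f_R0; rewrite Hstep; simpl INR.
    replace (2 * 0 * a) with 0 by ring; rewrite sin_0; ring.
  - rewrite tech5, Rmult_plus_distr_l, IH, Hstep; ring. }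
specialize (Htel M).
replace (2 * INR (S M) * a) with (0 + 2 * INR k * PI) in Htel
  by (unfold a; field; lra).
rewrite sin_period, sin_0 in Htel.
apply Rmult_integral in Htel; destruct Htel; [lra|assumption].
Qed.

(* The second difference of [1 - cos (k x)] in [k] is [2 cos (k x) (1 - cos x)];
   the weights cancel the factor [1 - cos x], so the second difference of the
   left-hand side vanishes by [sum_cos_node]. *)
Lemma quad_cos_small (M k : nat) : (k <= S M)%nat ->
  quad M (fun x => cos (INR k * x)) = INR k.
Proof.
set (L := fun k => quad M (fun x => cos (INR k * x))).
assert (HM : 0 < INR (S M)) by (apply lt_0_INR; lia).
assert (L0 : L 0%nat = 0).
{ apply sum_eq_R0; intros j _; simpl INR; rewrite !Rmult_0_l; ring. }
assert (L1 : L 1%nat = 1).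
{ unfold L, quad.
  transitivity (sum_f_R0 (fun _ => / INR (S M)) M).
  - apply sum_eq; intros j Hj; unfold weight.
    pose proof (one_minus_cos_node M j Hj).
    simpl (INR 1); rewrite Rmult_0_r, Rmult_1_l, cos_0; field; lra.
  - rewrite sum_cte; field; lra. }
assert (LS : forall i, (S i <= M)%nat -> L (S (S i)) = 2 * L (S i) - L i).
{ intros i Hi.
  assert (E : L (S (S i)) + L i - 2 * L (S i) = 0); [|lra].
  transitivity (2 / INR (S M)
    * sum_f_R0 (fun j => cos (INR (S i) * node M j)) M);
    [|rewrite sum_cos_node by lia; ring].
  unfold L, quad.
  rewrite !scal_sum, <- plus_sum.
  rewrite <- minus_sum; apply sum_eq; intros j Hj; unfold weight.
  pose proof (one_minus_cos_node M j Hj) as Hp.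
  rewrite !Rmult_0_r.
  set (x := node M j) in *.
  replace (INR (S (S i)) * x) with (INR (S i) * x + x)
    by (rewrite (S_INR (S i)); ring).
  replace (INR i * x) with (INR (S i) * x - x) by (rewrite (S_INR i); ring).
  rewrite cos_plus, cos_minus, cos_0; field; lra. }
(* The recurrence has order two, so two consecutive values are carried. *)
assert (H : forall i, (S i <= S M)%nat -> L i = INR i /\ L (S i) = INR (S i)).
{ induction i as [|i IH]; intros Hi; [now split|].
  destruct IH as [H1 H2]; [lia|split; [assumption|]].
  rewrite LS by lia; rewrite H1, H2, !S_INR; ring. }
destruct k as [|k]; intros Hk; [exact L0|].
now apply H.
Qed.

(** Beyond k = [S M] the exact value is lost; these bounds, uniform in [M], supply the domination
    for the limit. *)
Lemma quad_cos_bounds (M k : nat) :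
  0 <= quad M (fun x => cos (INR k * x)) <= INR k.
Proof.
assert (HM : 0 < INR (S M)) by (apply lt_0_INR; lia).
split.
- apply Rle_trans with (sum_f_R0 (fun _ => 0) M); [rewrite sum_cte; lra|].
  apply sum_Rle; intros j Hj.
  pose proof (weight_pos M j Hj); rewrite Rmult_0_r, cos_0.
  pose proof (COS_bound (INR k * node M j)); nra.
- destruct (Nat.le_gt_cases k (S M)) as [Hk|Hk];
    [rewrite quad_cos_small by assumption; lra|].
  apply Rle_trans with (INR (S M)); [|apply le_INR; lia].
  rewrite <- (quad_cos_small M (S M)) by lia.
  unfold quad; apply sum_Rle; intros j Hj.
  pose proof (weight_pos M j Hj); rewrite !Rmult_0_r, cos_0.
  (* at the nodes [cos ((M + 1) x) = -1] is minimal *)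
  replace (INR (S M) * node M j) with (PI + 2 * INR j * PI)
    by (unfold node; field; lra).
  rewrite cos_period, cos_PI.
  pose proof (COS_bound (INR k * node M j)); nra.
Qed.

(** * Limit passage and auxiliary facts on series *)

(** A discrete dominated convergence: [l - s] involves only terms of index above N, so it is at most
    a tail of [d], which tends to 0. *)
Lemma Series_nonpos_of_dominated (y : nat -> R) (Y : nat -> nat -> R) (d : nat -> R)
    (l : R) :
  is_series y l -> ex_series d ->
  (forall N, exists s, is_series (Y N) s /\ s <= 0) ->
  (forall N k, Rabs (y k - Y N k) <= d k) ->
  (forall N k, (k <= N)%nat -> Y N k = y k) ->
  l <= 0.
Proof.
intros Hy Hd HY Hdom Heq.
assert (Hd0 : forall k, 0 <= d k).
{ intros k; eapply Rle_trans; [apply Rabs_pos|apply (Hdom 0%nat)]. }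
assert (Hlim : is_lim_seq (fun N => Series d - sum_n d N) 0).
{ replace 0 with (Series d - Series d) by ring.
  apply is_lim_seq_minus'; [apply is_lim_seq_const|].
  exact (Series_correct d Hd). }
refine (is_lim_seq_le (fun _ => l) _ l 0 _ (is_lim_seq_const l) Hlim); intros N.
destruct (HY N) as (s & Hs & Hs0).
assert (Hdiff : is_series (fun k => y k - Y N k) (l - s))
  by (apply (is_series_minus y (Y N)); assumption).
(* The terms 0 to N of the difference vanish, so dropping [S N] terms leaves the sum unchanged. *)
assert (Hshift : is_series (fun k => y (S N + k)%nat - Y N (S N + k)%nat) (l - s)).
{ apply (is_series_incr_n (fun k => y k - Y N k)); [lia|].
  replace (sum_n _ _) with 0.
  - change (is_series (fun k => y k - Y N k) (l - s + 0)); now rewrite Rplus_0_r.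
  - symmetry; simpl Nat.pred.
    rewrite (sum_n_ext_loc _ (fun _ => 0)).
    + rewrite sum_n_const; ring.
    + intros k Hk; apply Rminus_diag_eq; now rewrite Heq. }
assert (Htail : is_series (fun k => d (S N + k)%nat) (Series d - sum_n d N)).
{ apply (is_series_incr_n d); [lia|].
  change (is_series d (Series d - sum_n d N + sum_n d N)).
  replace (Series d - sum_n d N + sum_n d N) with (Series d) by ring.
  now apply Series_correct. }
assert (Hle : l - s <= Series d - sum_n d N); [|lra].
rewrite <- (is_series_unique _ _ Hshift), <- (is_series_unique _ _ Htail).
assert (Habs : forall k, Rabs (y (S N + k)%nat - Y N (S N + k)%nat)
  <= d (S N + k)%nat) by (intros; apply Hdom).
eapply Rle_trans; [apply Rle_abs|].
eapply Rle_trans; [apply Series_Rabs|].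
- apply (ex_series_le (fun k => Rabs (y (S N + k)%nat - Y N (S N + k)%nat))
    (fun k => d (S N + k)%nat)).
  + intros k; change (norm ?a) with (Rabs a); rewrite Rabs_Rabsolu; apply Habs.
  + now exists (Series d - sum_n d N).
- apply Series_le; [|now exists (Series d - sum_n d N)].
  intros k; split; [apply Rabs_pos|apply Habs].
Qed.

(** Serves to add a correction at index 0, where a termwise formula is exceptional. *)
Lemma is_series_head (x : R) :
  is_series (fun k => if Nat.eqb k 0 then x else 0) x.
Proof.
apply (filterlim_ext (fun _ => x)); [|apply filterlim_const].
induction x0 as [|k IH]; [now rewrite sum_O|].
rewrite sum_Sn, <- IH; unfold plus; simpl; ring.
Qed.

Lemma ex_series_Rabs_of_weighted (u : nat -> R) :
  ex_series (fun k => INR k * Rabs (u k)) -> ex_series (fun k => Rabs (u k)).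
Proof.
intros H; apply ex_series_incr_1.
apply (ex_series_le (fun k => Rabs (u (S k))) (fun k => INR (S k) * Rabs (u (S k)))).
- intros k; change (norm ?a) with (Rabs a); rewrite Rabs_Rabsolu, S_INR.
  pose proof (pos_INR k); pose proof (Rabs_pos (u (S k))); nra.
- now apply (ex_series_incr_1 (fun k => INR k * Rabs (u k))).
Qed.

(** With truncated subtraction, [k - n + (n - k)] is the distance |k - n|, and cosine is even. *)
Lemma cos_dist (k n : nat) (x : R) :
  cos (INR (k - n + (n - k)) * x) = cos ((INR k - INR n) * x).
Proof.
destruct (Nat.le_gt_cases n k).
- replace (n - k)%nat with 0%nat by lia.
  now rewrite Nat.add_0_r, minus_INR by assumption.
- replace (k - n)%nat with 0%nat by lia.
  rewrite Nat.add_0_l, minus_INR by lia.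
  rewrite <- cos_neg; f_equal; ring.
Qed.

(** * The boundary inequality for the coefficients *)

(** Here [u k] + i [v k] are the Taylor coefficients of Q, and [S1] is the radial derivative of Re Q
    at 1. The last hypothesis says that Re Q is nonnegative on the circle. *)
Lemma boundary_derivative_bound (u v : nat -> R) (n : nat) (c beta S1 : R) :
  0 < c -> u 0%nat = c -> v 0%nat = 0 ->
  (forall k, (0 < k < n)%nat -> u k = 0 /\ v k = 0) ->
  ex_series (fun k => INR k * Rabs (u k)) ->
  ex_series (fun k => INR k * Rabs (v k)) ->
  is_series (fun k => INR k * u k) S1 ->
  is_series u 0 -> is_series v (- beta) ->
  (forall x, exists s, 0 <= s /\
     is_series (fun k => u k * cos (INR k * x) - v k * sin (INR k * x)) s) ->
  2 * c * S1 + INR n * (c ^ 2 + beta ^ 2) <= 0.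
Proof.
intros Hc Hu0 Hv0 Hgap Hku Hkv HS1 Hu Hv Hpos.
(* The test weight is [B + 2 Re (kappa e^{inx})] with
   [kappa = k1 + i k2 = (c + i beta)^2] and [B = 2 |kappa|]. *)
set (B := 2 * (c ^ 2 + beta ^ 2)).
set (k1 := c ^ 2 - beta ^ 2).
set (k2 := 2 * c * beta).
(* Taking [N + n] makes the quadrature exact at the frequencies k, k + n and |k - n| for all k up to
   N. *)
set (L := fun (N m : nat) => quad (N + n) (fun x => cos (INR m * x))).
set (dist := fun k => (k - n + (n - k))%nat).
(* The even part of the k-th term of Re Q times the test weight, by the product-to-sum formulas. *)
set (F := fun (k : nat) (x : R) =>
  (u k * B) * cos (INR k * x)
  + ((u k * k1 - v k * k2) * cos (INR (k + n) * x)
     + (u k * k1 + v k * k2) * cos (INR (dist k) * x))).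
set (w := fun x => B + 2 * (k1 * cos (INR n * x) - k2 * sin (INR n * x))).
(* With zeta = (c + i beta) e^{ih}, the weight is 2 |zeta|^2 + 2 Re (zeta^2) = 4 (Re zeta)^2. *)
assert (Hw : forall x, 0 <= w x).
{ intros x; unfold w, B, k1, k2.
  replace (INR n * x) with (2 * (INR n * x / 2)) by field.
  set (h := INR n * x / 2).
  rewrite cos_2a, sin_2a.
  pose proof (sin2_cos2 h) as H1; unfold Rsqr in H1.
  pose proof (pow2_ge_0 (c * cos h - beta * sin h)).
  replace (c ^ 2 + beta ^ 2)
    with ((c ^ 2 + beta ^ 2) * (sin h * sin h + cos h * cos h))
    by (rewrite H1; ring).
  nra. }
set (f := fun x =>
  Series (fun k => u k * cos (INR k * x) - v k * sin (INR k * x))).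
assert (Hf : forall x, 0 <= f x /\
  is_series (fun k => u k * cos (INR k * x) - v k * sin (INR k * x)) (f x)).
{ intros x; destruct (Hpos x) as (s & Hs & Hser).
  unfold f; rewrite (is_series_unique _ _ Hser); now split. }
(* Symmetrizing Re G removes the sines; it keeps the sign and the zero at x = 0. *)
set (E := fun x => / 2 * (f x * w x + f (- x) * w (- x))).
assert (HE : forall x, is_series (fun k => F k x) (E x)).
{ intros x.
  destruct (Hf x) as [_ H1], (Hf (- x)) as [_ H2].
  apply (is_series_scal_r (w x)) in H1.
  apply (is_series_scal_r (w (- x))) in H2.
  pose proof (is_series_scal_l (/ 2) _ _ (is_series_plus _ _ _ _ H1 H2)) as H.
  eapply is_series_ext; [|exact H].
  intros k; unfold F, w, dist, scal, plus; simpl; unfold mult; simpl.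
  rewrite cos_dist, plus_INR.
  rewrite (Rmult_plus_distr_r (INR k)), (Rmult_minus_distr_r (INR k)).
  rewrite cos_plus, cos_minus.
  rewrite <- !Ropp_mult_distr_r, !cos_neg, !sin_neg; field. }
assert (HE0 : E 0 = 0).
{ assert (Hf0 : f 0 = 0).
  { apply is_series_unique; eapply is_series_ext; [|exact Hu].
    intros k; simpl; rewrite Rmult_0_r, cos_0, sin_0; ring. }
  unfold E; rewrite Ropp_0, Hf0; ring. }
assert (HEpos : forall x, 0 <= E x).
{ intros x; unfold E.
  destruct (Hf x) as [H1 _], (Hf (- x)) as [H2 _].
  pose proof (Rmult_le_pos _ _ H1 (Hw x)).
  pose proof (Rmult_le_pos _ _ H2 (Hw (- x))); lra. }
(* [F] with each cos (m x) replaced by [l m]: [L N] gives the quadrature, [INR] the radial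
   derivative at 1. *)
set (T := fun (l : nat -> R) (k : nat) =>
  u k * B * l k
  + ((u k * k1 - v k * k2) * l (k + n)%nat + (u k * k1 + v k * k2) * l (dist k))).
(* For k >= n the term is 4 c^2 k u_k - 2 n k2 v_k, because B + 2 k1 = 4 c^2. At k = 0 the distance
   is n instead of -n, which adds 2 k1 n c. *)
assert (HT : is_series (T INR)
  (4 * c ^ 2 * S1 + 2 * INR n * k2 * beta + 2 * k1 * INR n * c)).
{ pose proof (is_series_plus _ _ _ _ (is_series_plus _ _ _ _
    (is_series_scal_l (4 * c ^ 2) _ _ HS1)
    (is_series_scal_l (- 2 * INR n * k2) _ _ Hv))
    (is_series_head (2 * k1 * INR n * c))) as H.
  unfold plus, scal in H; simpl in H; unfold mult in H; simpl in H.
  replace (4 * c ^ 2 * S1 + 2 * INR n * k2 * beta + 2 * k1 * INR n * c)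
    with (4 * (c * (c * 1)) * S1 + - 2 * INR n * k2 * - beta
          + 2 * k1 * INR n * c) by ring.
  eapply is_series_ext; [|exact H].
  intros k; unfold T, dist, B, k1, k2; simpl.
  destruct k as [|k].
  - simpl; rewrite Hu0, Hv0, Nat.sub_0_r; ring.
  - rewrite plus_INR.
    destruct (Nat.le_gt_cases n (S k)) as [Hk|Hk].
    + replace (n - S k)%nat with 0%nat by lia.
      rewrite Nat.add_0_r, minus_INR by assumption.
      cbn [Nat.eqb]; ring.
    + destruct (Hgap (S k)) as [-> ->]; [lia|]; cbn [Nat.eqb]; ring. }
assert (Hle : 4 * c ^ 2 * S1 + 2 * INR n * k2 * beta + 2 * k1 * INR n * c <= 0).
{ set (D := B + 2 * Rabs k1 + 2 * Rabs k2).
  apply (Series_nonpos_of_dominated (T INR) (fun N => T (L N))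
    (fun k => D * (INR k * Rabs (u k) + INR k * Rabs (v k)
                   + INR n * (Rabs (u k) + Rabs (v k)))));
    [exact HT| | | |].
  - exact (ex_series_scal_l D _ (ex_series_plus _ _
      (ex_series_plus _ _ Hku Hkv)
      (ex_series_scal_l (INR n) _ (ex_series_plus _ _
        (ex_series_Rabs_of_weighted u Hku) (ex_series_Rabs_of_weighted v Hkv))))).
  - intros N; exists (quad (N + n) E); split; [|now apply quad_nonpos].
    eapply is_series_ext; [|apply is_series_quad, HE].
    intros k; unfold F, T, L.
    rewrite !quad_plus, !quad_scal; reflexivity.
  - intros N k.
    assert (Hm : forall m, (m <= k + n)%nat ->
      Rabs (INR m - L N m) <= INR k + INR n).
    { intros m Hm; apply le_INR in Hm; rewrite plus_INR in Hm.
      pose proof (quad_cos_bounds (N + n) m) as Hb; fold (L N m) in Hb.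
      apply Rabs_le; lra. }
    pose proof (Hm k ltac:(lia)) as H1.
    pose proof (Hm (k + n)%nat ltac:(lia)) as H2.
    pose proof (Hm (dist k) ltac:(unfold dist; lia)) as H3.
    replace (T INR k - T (L N) k) with
      (u k * (B * (INR k - L N k)
              + k1 * ((INR (k + n) - L N (k + n)%nat)
                      + (INR (dist k) - L N (dist k))))
       + v k * (k2 * ((INR (dist k) - L N (dist k))
                      - (INR (k + n) - L N (k + n)%nat))))
      by (unfold T; ring).
    set (x1 := INR k - L N k) in *.
    set (x2 := INR (k + n) - L N (k + n)%nat) in *.
    set (x3 := INR (dist k) - L N (dist k)) in *.
    set (K := INR k + INR n) in *.
    assert (HB : 0 <= B) by (unfold B; nra).
    assert (HK : 0 <= K) by (pose proof (Rabs_pos x1); lra).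
    assert (Hu' : Rabs (B * x1 + k1 * (x2 + x3)) <= D * K).
    { eapply Rle_trans; [apply Rabs_triang|].
      rewrite !Rabs_mult, (Rabs_pos_eq B) by assumption.
      pose proof (Rabs_triang x2 x3); unfold D.
      pose proof (Rabs_pos k1); pose proof (Rabs_pos k2).
      pose proof (Rmult_le_compat_l B _ _ HB H1).
      assert (Rabs k1 * Rabs (x2 + x3) <= Rabs k1 * (2 * K))
        by (apply Rmult_le_compat_l; lra).
      nra. }
    assert (Hv' : Rabs (k2 * (x3 - x2)) <= D * K).
    { rewrite Rabs_mult.
      pose proof (Rabs_triang x3 (- x2)) as H; rewrite Rabs_Ropp in H.
      fold (x3 - x2) in H; unfold D.
      pose proof (Rabs_pos k1); pose proof (Rabs_pos k2).
      assert (Rabs k2 * Rabs (x3 - x2) <= Rabs k2 * (2 * K))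
        by (apply Rmult_le_compat_l; lra).
      nra. }
    eapply Rle_trans; [apply Rabs_triang|].
    rewrite (Rabs_mult (u k)), (Rabs_mult (v k)).
    pose proof (Rmult_le_compat_l _ _ _ (Rabs_pos (u k)) Hu').
    pose proof (Rmult_le_compat_l _ _ _ (Rabs_pos (v k)) Hv').
    unfold K in *; lra.
  - intros N k Hk; unfold T, L, dist.
    rewrite !quad_cos_small by lia; reflexivity. }
(* For this kappa the bound is 2 c times the claim. *)
unfold k1, k2 in Hle.
apply Rmult_le_reg_l with (2 * c); [lra|].
eapply Rle_trans; [right|rewrite Rmult_0_r; exact Hle]; ring.
Qed.

(** * Complex power series in real and imaginary parts *)

Lemma is_series_Re (s : nat -> C) (l : C) :
  @is_series C_AbsRing C_NormedModule s l -> is_series (fun k => Re (s k)) (Re l).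
Proof.
intros H.
apply (filterlim_ext (fun N => Re (@sum_n C_AbelianMonoid s N))).
- induction x as [|N IH]; [now rewrite !sum_O|].
  now rewrite !sum_Sn, <- IH.
- eapply filterlim_comp; [exact H|].
  intros P [e He]; exists e; intros y [Hy _]; now apply He.
Qed.

Lemma is_series_Im (s : nat -> C) (l : C) :
  @is_series C_AbsRing C_NormedModule s l -> is_series (fun k => Im (s k)) (Im l).
Proof.
intros H.
apply (filterlim_ext (fun N => Im (@sum_n C_AbelianMonoid s N))).
- induction x as [|N IH]; [now rewrite !sum_O|].
  now rewrite !sum_Sn, <- IH.
- eapply filterlim_comp; [exact H|].
  intros P [e He]; exists e; intros y [_ Hy]; now apply He.
Qed.

Lemma is_pseries_mul (a : nat -> C) (z w l : C) :
  @is_pseries C_AbsRing C_NormedModule a (z * w)%C l ->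
  @is_series C_AbsRing C_NormedModule
    (fun k => (@pow_n C_Ring w k * (@pow_n C_Ring z k * a k))%C) l.
Proof.
apply is_series_ext; intros k.
assert (H : @pow_n C_Ring (z * w)%C k
  = (@pow_n C_Ring z k * @pow_n C_Ring w k)%C).
{ induction k as [|k IH]; simpl.
  - change (RtoC 1 = RtoC 1 * RtoC 1)%C; ring.
  - rewrite IH; unfold mult; simpl; ring. }
change (@pow_n C_Ring (z * w)%C k * a k
  = @pow_n C_Ring w k * (@pow_n C_Ring z k * a k))%C.
rewrite H; ring.
Qed.

Lemma pow_n_RtoC (x : R) (k : nat) : @pow_n C_Ring (RtoC x) k = RtoC (x ^ k).
Proof.
induction k as [|k IH]; [reflexivity|].
simpl; rewrite IH, RtoC_mult; reflexivity.
Qed.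

Lemma pow_n_circle (x : R) (k : nat) :
  @pow_n C_Ring (cos x, sin x) k = (cos (INR k * x), sin (INR k * x)).
Proof.
induction k as [|k IH].
- simpl; rewrite Rmult_0_l, cos_0, sin_0; reflexivity.
- rewrite S_INR, Rmult_plus_distr_r, Rmult_1_l, cos_plus, sin_plus.
  change (@pow_n C_Ring (cos x, sin x) (S k))
    with (Cmult (cos x, sin x) (@pow_n C_Ring (cos x, sin x) k)).
  rewrite IH; unfold Cmult; simpl; f_equal; ring.
Qed.

(** * Derivatives of Re p along rays and circles *)

(** The linear part is Re (l (h + i k)) = Re l h - Im l k. The factor sqrt 2 passes between the
    modulus and the maximum of the coordinates. *)
Lemma differentiable_pt_lim_Re (p : C -> C) (z l : C) :
  @is_derive C_AbsRing C_NormedModule p z l ->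
  differentiable_pt_lim (fun x y => Re (p (x, y))) (Re z) (Im z) (Re l) (- Im l).
Proof.
intros [_ Hd] eps.
assert (H2 : 0 < sqrt 2) by (apply sqrt_lt_R0; lra).
assert (He : 0 < eps / sqrt 2) by (apply Rdiv_lt_0_compat; [apply eps|exact H2]).
destruct (Hd z (fun P HP => HP) (mkposreal _ He)) as [d Hdd].
assert (Hd2 : 0 < d / sqrt 2) by (apply Rdiv_lt_0_compat; [apply d|exact H2]).
exists (mkposreal _ Hd2); simpl; intros x y Hx Hy.
pose proof (Cmod_2Rmax ((x, y) - z)%C) as Hm.
change (Cmod ((x, y) - z) <= sqrt 2 * Rmax (Rabs (x - Re z)) (Rabs (y - Im z)))
  in Hm.
assert (Hball : Cmod ((x, y) - z)%C < d).
{ eapply Rle_lt_trans; [exact Hm|].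
  replace (pos d) with (sqrt 2 * (d / sqrt 2)) by (field; lra).
  apply Rmult_lt_compat_l; [exact H2|]; now apply Rmax_lub_lt. }
specialize (Hdd (x, y) Hball).
change (Cmod (p (x, y) - p z - ((x, y) - z) * l)
        <= eps / sqrt 2 * Cmod ((x, y) - z)%C) in Hdd.
pose proof (re_le_Cmod (p (x, y) - p z - ((x, y) - z) * l)%C) as HR.
replace (Re (p (x, y)) - Re (p (Re z, Im z))
         - (Re l * (x - Re z) + - Im l * (y - Im z)))
  with (Re (p (x, y) - p z - ((x, y) - z) * l)%C)
  by (destruct z; unfold Re, Im; simpl; ring).
eapply Rle_trans; [exact HR|]; eapply Rle_trans; [exact Hdd|].
eapply Rle_trans; [apply Rmult_le_compat_l; [lra|exact Hm]|].
right; field; lra.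
Qed.

Lemma derivable_Re_radial (p : C -> C) (z l : C) :
  @is_derive C_AbsRing C_NormedModule p z l ->
  derivable_pt_lim (fun t => Re (p (z * RtoC t)%C)) 1 (Re (z * l)%C).
Proof.
intros Hd.
assert (Hlin : forall a, derivable_pt_lim (fun t => a * t) 1 a).
{ intros a; apply is_derive_Reals; auto_derive; [easy|ring]. }
pose proof (derivable_pt_lim_comp_2d (fun x y => Re (p (x, y)))
  (fun t => Re z * t) (fun t => Im z * t) 1 (Re l) (- Im l) (Re z) (Im z)) as H.
rewrite !Rmult_1_r in H.
specialize (H (differentiable_pt_lim_Re p z l Hd) (Hlin _) (Hlin _)).
replace (Re (z * l)%C) with (Re l * Re z + - Im l * Im z)
  by (destruct z, l; unfold Re, Im; simpl; ring).
apply is_derive_Reals; apply is_derive_Reals in H.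
eapply is_derive_ext; [|exact H].
intros t; apply (f_equal (fun w => Re (p w))), injective_projections;
  unfold Re, Im; simpl; ring.
Qed.

(** The velocity of z e^{it} at t = 0 is i z, and Re (i z l) = - Im (z l). *)
Lemma derivable_Re_tangential (p : C -> C) (z l : C) :
  @is_derive C_AbsRing C_NormedModule p z l ->
  derivable_pt_lim (fun t => Re (p (z * (cos t, sin t))%C)) 0 (- Im (z * l)%C).
Proof.
intros Hd.
pose proof (derivable_pt_lim_comp_2d (fun x y => Re (p (x, y)))
  (fun t => Re z * cos t - Im z * sin t) (fun t => Re z * sin t + Im z * cos t)
  0 (Re l) (- Im l) (- Im z) (Re z)) as H.
cbv beta in H; rewrite cos_0, sin_0, !Rmult_0_r, !Rmult_1_r, Rminus_0_r, Rplus_0_l in H.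
replace (- Im (z * l)%C) with (Re l * - Im z + - Im l * Re z)
  by (destruct z, l; unfold Re, Im; simpl; ring).
apply is_derive_Reals; eapply is_derive_ext; [|apply is_derive_Reals, H].
- intros t; apply (f_equal (fun w => Re (p w))), injective_projections;
    unfold Re, Im; simpl; ring.
- now apply differentiable_pt_lim_Re.
- apply is_derive_Reals; auto_derive; [easy|rewrite cos_0, sin_0; ring].
- apply is_derive_Reals; auto_derive; [easy|rewrite cos_0, sin_0; ring].
Qed.

(** A positive value would persist, by continuity along the radius, at points (1 - h) z of smaller
    modulus. *)
Lemma Re_nonpos_on_circle (p : C -> C) (z : C) :
  @ex_derive C_AbsRing C_NormedModule p z -> z <> 0%C ->
  (forall w, Cmod w < Cmod z -> Re (p w) < 0) -> Re (p z) <= 0.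
Proof.
intros [l Hd] Hz Hneg.
destruct (Rle_lt_dec (Re (p z)) 0) as [H|H]; [exact H|exfalso].
assert (Hc : continuity_pt (fun t => Re (p (z * RtoC t)%C)) 1).
{ apply derivable_continuous_pt; eexists; exact (derivable_Re_radial p z l Hd). }
destruct (Hc _ H) as (d & Hd0 & Hlim).
set (h := Rmin (d / 2) (1 / 2)).
assert (Hh : 0 < h <= 1 / 2 /\ h < d).
{ pose proof (Rmin_l (d / 2) (1 / 2)); pose proof (Rmin_r (d / 2) (1 / 2)).
  assert (0 < h) by (apply Rmin_glb_lt; lra); unfold h in *; lra. }
specialize (Hlim (1 - h)); simpl in Hlim; unfold Rdist in Hlim.
assert (Hz1 : (z * RtoC 1)%C = z) by ring.
rewrite Hz1 in Hlim.
assert (Hlt : Re (p (z * RtoC (1 - h))%C) < 0).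
{ apply Hneg; rewrite Cmod_mult, Cmod_R, Rabs_pos_eq by lra.
  pose proof (Cmod_gt_0 z) as [Hm _]; specialize (Hm Hz); nra. }
assert (Hab : Rabs (Re (p (z * RtoC (1 - h))%C) - Re (p z)) < Re (p z)).
{ apply Hlim; split; [split; [exact I|lra]|].
  apply Rabs_def1; lra. }
apply Rabs_def2 in Hab; lra.
Qed.

(** * Radius of convergence and termwise derivative at 1 *)

(** Terms of a convergent series tend to 0, which fails outside the disk of convergence; hence the
    radius is at least x. *)
Lemma CV_radius_gt_1 (u : nat -> R) (x : R) :
  1 < x -> ex_series (fun k => x ^ k * u k) -> Rbar_lt 1 (CV_radius u).
Proof.
intros Hx Hs.
apply Rbar_lt_le_trans with x; [exact Hx|].
apply Rbar_not_lt_le; intros Hlt.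
apply (CV_disk_outside u x); [now rewrite Rabs_pos_eq by lra|].
apply is_lim_seq_ext with (fun k => x ^ k * u k); [intros; ring|].
now apply ex_series_lim_0.
Qed.

(** The differentiated series has the same radius, so it converges absolutely at 1. *)
Lemma ex_series_weighted (u : nat -> R) :
  Rbar_lt 1 (CV_radius u) -> ex_series (fun k => INR k * Rabs (u k)).
Proof.
intros Hr; apply ex_series_incr_1.
rewrite <- CV_radius_derive, <- Rabs_R1 in Hr; apply CV_disk_inside in Hr.
eapply ex_series_ext; [|exact Hr].
intros k; unfold PS_derive; cbv beta.
rewrite pow1, Rmult_1_r, Rabs_mult, (Rabs_pos_eq (INR (S k))); [reflexivity|].
apply pos_INR.
Qed.

Lemma is_derive_PSeries_1 (u : nat -> R) :
  Rbar_lt 1 (CV_radius u) ->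
  is_derive (PSeries u) 1 (Series (fun k => INR k * u k)).
Proof.
intros Hr.
replace (Series (fun k => INR k * u k)) with (PSeries (PS_derive u) 1).
- apply is_derive_PSeries; now rewrite Rabs_R1.
- rewrite Series_incr_1.
  + simpl (INR 0); rewrite Rmult_0_l, Rplus_0_l.
    apply Series_ext; intros k; unfold PS_derive; rewrite pow1; ring.
  + apply ex_series_Rabs; eapply ex_series_ext; [|exact (ex_series_weighted u Hr)].
    intros k; cbv beta; rewrite Rabs_mult, (Rabs_pos_eq (INR k)); [reflexivity|].
    apply pos_INR.
Qed.

(** * Transfer to the boundary inequality and conclusion *)

Theorem theorem2 (n : nat) (hn : (0 < n)%nat) (a0 : R) (ha0 : (a0 < 0)%R)
    (p : C -> C) (hp : H_class (RtoC a0) n p)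
    (z0 : C) (hz0 : unit_disk z0)
    (hneg : forall z : C, (Cmod z < Cmod z0)%R -> (Re (p z) < 0)%R)
    (beta : R) (hbeta : beta <> 0%R)
    (hpz0 : p z0 = (RtoC beta * Ci)%C) :
  exists l : R,
    (z0 * C_derive p z0 / p z0)%C = (Ci * RtoC l)%C /\
    ((beta < 0)%R ->
       (l >= INR n / 2 * (a0 / beta + beta / a0))%R /\
       (INR n / 2 * (a0 / beta + beta / a0) >= INR n)%R) /\
    ((beta > 0)%R ->
       (l <= INR n / 2 * (a0 / beta + beta / a0))%R /\
       (INR n / 2 * (a0 / beta + beta / a0) <= - INR n)%R).
Proof.
destruct hp as [Han (a & Ha0 & Hgap & Hser)]; unfold unit_disk in *.
set (d := C_derive p z0).
assert (Hd : @is_derive C_AbsRing C_NormedModule p z0 d)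
  by (apply C_derive_correct; [exact z0|now apply Han]).
(* The Taylor coefficients of w -> p (z0 w). *)
set (q := fun k => (@pow_n C_Ring z0 k * a k)%C).
assert (Hq0 : q 0%nat = RtoC a0)
  by (unfold q; rewrite Ha0; change (RtoC 1 * RtoC a0 = RtoC a0)%C; ring).
assert (Hq : forall w, Cmod z0 * Cmod w < 1 ->
  @is_series C_AbsRing C_NormedModule (fun k => (@pow_n C_Ring w k * q k)%C)
    (p (z0 * w)%C)).
{ intros w Hw; apply is_pseries_mul, Hser; now rewrite Cmod_mult. }
assert (Hreal : forall t, Cmod z0 * Rabs t < 1 ->
  @is_series C_AbsRing C_NormedModule (fun k => (RtoC (t ^ k) * q k)%C)
    (p (z0 * RtoC t)%C)).
{ intros t Ht; rewrite <- Cmod_R in Ht.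
  eapply is_series_ext; [|exact (Hq _ Ht)].
  intros k; cbv beta; now rewrite pow_n_RtoC. }
(* At the origin the series has real part a0 < 0, whereas Re (beta i) = 0. *)
assert (Hz0 : z0 <> 0%C).
{ intros ->.
  assert (H : Cmod 0 * Rabs 0 < 1) by (rewrite Cmod_0; lra).
  apply Hreal, is_series_Re, is_series_unique in H.
  rewrite Cmult_0_l, hpz0 in H.
  assert (H' : is_series (fun k => Re (RtoC (0 ^ k) * q k)%C) a0).
  { eapply is_series_ext; [|exact (is_series_head a0)].
    intros [|k].
    - change (a0 = Re (RtoC 1 * q 0%nat)%C); rewrite Hq0; simpl; ring.
    - cbn [Nat.eqb]; rewrite pow_i by lia; simpl; ring. }
  rewrite (is_series_unique _ _ H') in H; simpl in H; lra. }
assert (Hr : 0 < Cmod z0) by now apply Cmod_gt_0.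
set (u := fun k => - Re (q k)).
set (v := fun k => - Im (q k)).
assert (HuR : forall t, Cmod z0 * Rabs t < 1 ->
  is_series (fun k => t ^ k * u k) (- Re (p (z0 * RtoC t)%C))).
{ intros t Ht.
  pose proof (is_series_opp _ _ (is_series_Re _ _ (Hreal t Ht))) as H.
  eapply is_series_ext; [|exact H].
  intros k; unfold u, opp; simpl; unfold Re, Im; ring. }
assert (HvR : forall t, Cmod z0 * Rabs t < 1 ->
  is_series (fun k => t ^ k * v k) (- Im (p (z0 * RtoC t)%C))).
{ intros t Ht.
  pose proof (is_series_opp _ _ (is_series_Im _ _ (Hreal t Ht))) as H.
  eapply is_series_ext; [|exact H].
  intros k; unfold v, opp; simpl; unfold Re, Im; ring. }
(* The midpoint of 1 and 1 / |z0|: the rescaled series converges beyond the unit circle. *)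
assert (Hx : exists x, 1 < x /\ forall t, Rabs t <= x -> Cmod z0 * Rabs t < 1).
{ exists ((1 + / Cmod z0) / 2).
  assert (Hi : Cmod z0 * / Cmod z0 = 1) by (field; lra).
  split; [nra|].
  intros t Ht; apply Rle_lt_trans with (Cmod z0 * ((1 + / Cmod z0) / 2)); nra. }
destruct Hx as (x & Hx1 & Hxt).
assert (Hxx : Cmod z0 * Rabs x < 1) by (apply Hxt; rewrite Rabs_pos_eq; lra).
assert (Hru : Rbar_lt 1 (CV_radius u))
  by (apply (CV_radius_gt_1 u x Hx1); eexists; exact (HuR x Hxx)).
assert (Hrv : Rbar_lt 1 (CV_radius v))
  by (apply (CV_radius_gt_1 v x Hx1); eexists; exact (HvR x Hxx)).
assert (H11 : Cmod z0 * Rabs 1 < 1) by (apply Hxt; rewrite Rabs_R1; lra).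
assert (Hz01 : (z0 * RtoC 1)%C = z0) by ring.
assert (Hu : is_series u 0).
{ specialize (HuR 1 H11); rewrite Hz01, hpz0 in HuR.
  replace 0 with (- Re (RtoC beta * Ci)%C) by (simpl; ring).
  eapply is_series_ext; [|exact HuR].
  intros k; cbv beta; rewrite pow1; apply Rmult_1_l. }
assert (Hv : is_series v (- beta)).
{ specialize (HvR 1 H11); rewrite Hz01, hpz0 in HvR.
  replace beta with (Im (RtoC beta * Ci)%C) by (simpl; ring).
  eapply is_series_ext; [|exact HvR].
  intros k; cbv beta; rewrite pow1; apply Rmult_1_l. }
(* Both sides are the radial derivative of Re Q at 1, from the series and by the chain rule. *)
assert (HS1 : Series (fun k => INR k * u k) = - Re (z0 * d)%C).
{ pose proof (is_derive_PSeries_1 u Hru) as H1.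
  pose proof (derivable_Re_radial p z0 d Hd) as H2.
  apply is_derive_Reals in H2.
  assert (H3 : is_derive (fun t => - Re (p (z0 * RtoC t)%C)) 1 (- Re (z0 * d)%C))
    by exact (is_derive_opp _ _ _ H2).
  rewrite <- (is_derive_unique _ _ _ H1), <- (is_derive_unique _ _ _ H3).
  apply Derive_ext_loc.
  assert (Hx0 : 0 < x - 1) by lra.
  exists (mkposreal _ Hx0); intros t Ht.
  change (Rabs (t - 1) < x - 1) in Ht; apply Rabs_def2 in Ht.
  assert (Ht' : Cmod z0 * Rabs t < 1) by (apply Hxt, Rabs_le; lra).
  unfold PSeries; rewrite <- (is_series_unique _ _ (HuR t Ht')).
  apply Series_ext; intros; ring. }
assert (Hpolar : forall t, Cmod (cos t, sin t) = 1).
{ intros t; unfold Cmod; simpl.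
  replace (_ + _) with 1; [apply sqrt_1|].
  pose proof (sin2_cos2 t) as H; unfold Rsqr in H; lra. }
assert (Hcirc : forall t, Re (p (z0 * (cos t, sin t))%C) <= 0).
{ intros t.
  assert (Hm : Cmod (z0 * (cos t, sin t))%C = Cmod z0)
    by (rewrite Cmod_mult, Hpolar; ring).
  apply Re_nonpos_on_circle.
  - apply Han; unfold unit_disk; now rewrite Hm.
  - intros H; rewrite H, Cmod_0 in Hm; lra.
  - intros w; rewrite Hm; apply hneg. }
(* On the circle Re p is at most 0, its value at z0, so the tangential derivative vanishes there. *)
assert (Him : Im (z0 * d)%C = 0).
{ pose proof (derivable_Re_tangential p z0 d Hd) as H.
  set (g := fun t => Re (p (z0 * (cos t, sin t))%C)) in *.
  assert (Hg : derive_pt g 0 (exist _ _ H) = 0).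
  { apply (deriv_maximum g (- 1) 1); [lra|lra|].
    intros t _ _; unfold g at 2; rewrite cos_0, sin_0.
    replace (z0 * (1, 0))%C with z0 by (change (z0 = z0 * RtoC 1)%C; ring).
    rewrite hpz0; simpl.
    replace (beta * 0 - 0 * 1) with 0 by ring; apply Hcirc. }
  change (- Im (z0 * d)%C = 0) in Hg; lra. }
set (m := Re (z0 * d)%C) in *.
assert (Hzd : (z0 * d)%C = RtoC m)
  by (apply injective_projections; [reflexivity|exact Him]).
assert (Hmain : 2 * (- a0) * (- m) + INR n * ((- a0) ^ 2 + beta ^ 2) <= 0).
{ apply (boundary_derivative_bound u v n); try assumption.
  - lra.
  - unfold u; now rewrite Hq0.
  - unfold v; rewrite Hq0; simpl; ring.
  - intros k Hk; unfold u, v, q; rewrite (Hgap k Hk), Cmult_0_r; simpl; lra.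
  - now apply ex_series_weighted.
  - now apply ex_series_weighted.
  - rewrite <- HS1; apply Series_correct, ex_series_Rabs.
    eapply ex_series_ext; [|exact (ex_series_weighted u Hru)].
    intros k; cbv beta; rewrite Rabs_mult, (Rabs_pos_eq (INR k)); [reflexivity|].
    apply pos_INR.
  - intros t; exists (- Re (p (z0 * (cos t, sin t))%C)); split.
    + pose proof (Hcirc t); lra.
    + assert (Ht : Cmod z0 * Cmod (cos t, sin t) < 1) by (rewrite Hpolar; lra).
      pose proof (is_series_opp _ _ (is_series_Re _ _ (Hq _ Ht))) as H.
      eapply is_series_ext; [|exact H].
      intros k; cbv beta; rewrite pow_n_circle.
      unfold u, v, opp; simpl; unfold Re, Im; ring. }
(* From m / (i beta) = - i m / beta. *)
exists (- m / beta).
assert (Hn : 0 < INR n) by now apply lt_0_INR.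
(* A real common denominator; as a0 < 0, its sign is opposite to that of beta, which decides the
   direction of both inequalities. *)
set (i := / (a0 * beta)).
assert (Hl : - m / beta = - m * a0 * i) by (unfold i; field; lra).
assert (Hsum : a0 / beta + beta / a0 = (a0 ^ 2 + beta ^ 2) * i)
  by (unfold i; field; lra).
assert (Hone : a0 * beta * i = 1) by (unfold i; field; lra).
rewrite Hsum, Hl.
split; [|split; intros Hb].
- rewrite <- Hl, Hzd, hpz0.
  apply injective_projections; simpl; field; nra.
- assert (Hi : 0 < i) by (apply Rinv_0_lt_compat; nra).
  pose proof (Rmult_le_compat_r i _ _ (Rlt_le _ _ Hi) Hmain).
  (* Expanding (a0 - beta)^2 >= 0 bounds the sum of the two ratios below by 2; for beta > 0 the
     square of a0 + beta bounds it above by -2. *)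
  pose proof (Rmult_le_pos _ _ (pow2_ge_0 (a0 - beta)) (Rlt_le _ _ Hi)).
  split; [nra|].
  assert (2 <= (a0 ^ 2 + beta ^ 2) * i) by nra; nra.
- assert (Hi : i < 0) by (apply Rinv_lt_0_compat; nra).
  pose proof (Rmult_le_compat_neg_l i _ _ (Rlt_le _ _ Hi) Hmain).
  pose proof (Rmult_le_compat_neg_l i _ _ (Rlt_le _ _ Hi) (pow2_ge_0 (a0 + beta))).
  split; [nra|].
  assert ((a0 ^ 2 + beta ^ 2) * i <= - 2) by nra; nra.
Qed.
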